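(* Let $P_1(n)$ be the number of payphone permutations of type (P1) and size $n$. Then for any integer $n\geq 1$, $$P_1(n) = \sum_{i=1}^n G\big(S'(i-1)\cup S'(n-i)\big).$$
   Context: Multisets: $\#_k M$ denotes the multiplicity of $k$ in the multiset $M$, and $\cup$ denotes union of multisets with multiplicities added. For $n\ge 0$, the finite multiset $S(n)$ of positive integers is defined recursively by $S(0)=\emptyset$ and $$S(n)=\{n\}\cup S\left(\left\lfloor\tfrac{n-1}{2}\right\rfloor\right)\cup S\left(\left\lceil\tfrac{n-1}{2}\right\rceil\right)\quad (n\ge 1).$$ Further, $S'(0):=\emptyset$ and $S'(\ell):=S(\ell-1)\cup\{2\ell-1\}$ for $\ell\ge 1$. The function $G$ is defined on the finite multisets $M$ of positive integers by $$G(M) := \bigg(\prod_{k\geq 1} (\#_{2k} M + \#_{2k-1} M)!\bigg) \cdot 2^{\sum_{k\geq 2} \#_{2k} M}.$$ Type (P1) payphone permutations: $n$ payphones, labeled $1,\dots,n$, are arranged in a row; the distance between payphones $i$ and $j$ is $|i-j|$. Persons $1,2,\dots,n$ come one after another and each occupies an available payphone. The first person takes any payphone. Each subsequent person obeys rule (P1): the person takes any available payphone such that its closest occupied payphone is as distant as possible (i.e., among all available payphones, one maximizing the distance to the set of occupied payphones). The resulting assignment of people to payphones, $(p_1,\dots,p_n)$ with $p_j$ the person occupying payphone $j$, is a payphone permutation of type (P1) and size $n$; $P_1(n)$ counts the distinct permutations of $\{1,\dots,n\}$ that can arise this way. *)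

(* Defs.v *)
From mathcomp Require Import all_boot all_fingroup all_algebra.
From mathcomp Require Import finmap multiset.
Set Implicit Arguments.
Unset Strict Implicit.
Unset Printing Implicit Defensive.

Local Open Scope nat_scope.
Local Open Scope mset_scope.

(* Payphones and persons are both indexed from 0, i.e. payphone (resp. person)
   [i : 'I_n] is the one labeled i + 1.  A permutation [p : 'S_n] is read as the
   assignment in which [p j] is the person occupying payphone [j]. *)

(* The default value [n] of the minimum exceeds all distances; [dist_occ j A]
   is only used for nonempty [A]. *)
Definition dist_occ n (j : 'I_n) (A : {set 'I_n}) : nat :=
  \big[minn/n]_(i in A) `|j - i|%N.

Definition P1_choice n (A : {set 'I_n}) (j : 'I_n) : bool :=
  (j \notin A) &&
  ((A == set0) || [forall k, (k \notin A) ==> (dist_occ k A <= dist_occ j A)]).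

Definition occupied_before n (p : {perm 'I_n}) (t : 'I_n) : {set 'I_n} :=
  [set j | p j < t].

Definition payphone_perm1 n (p : {perm 'I_n}) : bool :=
  [forall j, P1_choice (occupied_before p (p j)) j].

Definition P1 n : nat := #|[set p : {perm 'I_n} | payphone_perm1 p]|.

(* Structural recursion on a bound [b] for the argument; see [gapS_succ]. *)
Fixpoint gapS_rec (b n : nat) : {mset nat} :=
  match b, n with
  | b'.+1, m.+1 => [mset n] `+` gapS_rec b' m./2 `+` gapS_rec b' (uphalf m)
  | _, _ => mset0
  end.

(* The multiset S(n). *)
Definition gapS (n : nat) : {mset nat} := gapS_rec n n.

Lemma gapS_recE b n : n <= b -> gapS_rec b n = gapS n.
Proof.
rewrite /gapS; have [c] := ubnP n.
elim: c n b => // c IHc [|m] [|b] //= mc mb.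
have le1 : m./2 <= m by rewrite leq_half_double -addnn leqW ?leq_addr.
have le2 : uphalf m <= m by rewrite leq_uphalf_double -addnn leq_addr.
have lt1 : m./2 < c by apply: leq_ltn_trans le1 mc.
have lt2 : uphalf m < c by apply: leq_ltn_trans le2 mc.
have mb' : m <= b by [].
by rewrite !(IHc _ b) ?(IHc _ m) ?(leq_trans _ mb').
Qed.

Lemma gapS0 : gapS 0 = mset0.
Proof. by []. Qed.

(* For n = m + 1, [m./2] and [uphalf m] are the floor and ceiling of (n - 1)/2. *)
Lemma gapS_succ m :
  gapS m.+1 = [mset m.+1] `+` gapS m./2 `+` gapS (uphalf m).
Proof.
rewrite {1}/gapS /= !gapS_recE //.
- by rewrite leq_uphalf_double -addnn leq_addr.
- by rewrite leq_half_double -addnn leqW ?leq_addr.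
Qed.

(* The multiset S'(l). *)
Definition gapS' (l : nat) : {mset nat} :=
  if l == 0 then mset0 else gapS l.-1 `+` [mset (2 * l).-1].

Definition mset_max (M : {mset nat}) : nat := \max_(m <- finsupp M) m.

(* All factors (resp. summands) with k > mset_max M are 1 (resp. 0), so the
   product over all k >= 1 and the sum over all k >= 2 are truncated there; see
   [G_bound]. *)
Definition G (M : {mset nat}) : nat :=
  (\prod_(1 <= k < (mset_max M).+1) (M (2 * k) + M (2 * k - 1))`!)
  * 2 ^ (\sum_(2 <= k < (mset_max M).+1) M (2 * k)).

Lemma mset_max_lt (M : {mset nat}) m : mset_max M < m -> M m = 0.
Proof.
move=> lt_m; apply/mset_eq0P; rewrite -msuppE; apply/negP => mM.
by move: lt_m; rewrite ltnNge /mset_max (big_rem m) //= leq_maxl.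
Qed.

Lemma G_bound (M : {mset nat}) N : mset_max M <= N ->
  G M = (\prod_(1 <= k < N.+1) (M (2 * k) + M (2 * k - 1))`!)
        * 2 ^ (\sum_(2 <= k < N.+1) M (2 * k)).
Proof.
move=> leN; rewrite /G; set b := mset_max M in leN *.
have z k m : b < k -> k <= m -> M m = 0.
  by move=> bk km; apply: mset_max_lt; apply: leq_trans bk km.
have le2 k : 0 < k -> k <= 2 * k - 1.
  by case: k => // k _; rewrite mul2n -addnn addSn subn1 /= leq_addl.
have leD k : k <= 2 * k by rewrite mul2n -addnn leq_addr.
congr (_ * 2 ^ _).
  rewrite [RHS](@big_cat_nat _ _ _ b.+1) //= -[LHS]muln1; congr (_ * _).
  rewrite big_nat_cond big1 // => k /andP[/andP[bk _] _].
  rewrite (z k (2 * k)) // (z k (2 * k - 1)) //.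
  by apply: le2; apply: leq_trans bk.
have [b0|b1] := posnP b.
  rewrite !b0 big_geq // big_nat_cond big1 // => k /andP[/andP[k2 _] _].
  by apply: (z k) => //; rewrite b0; apply: leq_trans k2.
rewrite [RHS](@big_cat_nat _ _ _ b.+1) //= -[LHS]addn0; congr (_ + _).
rewrite big_nat_cond big1 // => k /andP[/andP[bk _] _].
exact: (z k).
Qed.

(* Main.v *)
(* Let A be a nonempty set of occupied payphones, and let M(A) be the sum of
   S(m) over the gaps of length m between two occupied payphones and of S'(l)
   over the two boundary gaps.  A gap with head element 2k or 2k-1 (a boundary
   gap of length l has head 2l-1) offers distance k, so the next person splits a
   gap whose head is in the top level {2k, 2k-1} of M(A), and M(A) loses exactly
   that head.  Double counting the choices shows that G(M(A)) is the sum of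
   G(M(x |: A)) over all admissible x, so G(M(A)) counts the completions of A;
   summing over the position of the first person gives the formula. *)
Require Import Defs.
From HB Require Import structures.
From mathcomp Require Import all_boot all_fingroup all_algebra.
From mathcomp Require Import finmap multiset.
From mathcomp Require Import zify.

Local Open Scope nat_scope.
Local Open Scope mset_scope.

(** * Counting permutations produced by a sequential rule *)

Lemma occupied_before_agree n (p q : {perm 'I_n}) (t : nat) :
  (forall j, q j < t -> p j = q j) -> forall j, (p j < t) = (q j < t).
Proof.
move=> agr j; apply/idP/idP=> [pj|qj]; last by rewrite agr.
(* Under [q] the person [p j] sits at [i]; agreement at [i] and injectivity of [p] force [i = j]. *)
pose i := (q^-1)%g (p j).
have qi : q i = p j by rewrite permKV.
have pi : p i = p j by rewrite agr qi.
by rewrite -(perm_inj pi) qi.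
Qed.

(** The rule sees only the occupied set and not the order in which it was filled, so the number of
    completions is a function [C] of that set, determined by recursion on the next choice. *)
Lemma card_perm_rule n (R : {set 'I_n} -> pred 'I_n) (C : {set 'I_n} -> nat) :
  (forall A x, R A x -> x \notin A) -> C setT = 1 ->
  (forall A, A != setT -> C A = \sum_(x | R A x) C (x |: A)) ->
  #|[set p : {perm 'I_n} | [forall j, R (occupied_before p (p j)) j]]| = C set0.
Proof.
move=> RA CT CS.
pose V (p : {perm 'I_n}) := [forall j, R (occupied_before p (p j)) j].
pose agree t (q p : {perm 'I_n}) := [forall j, (q j < t) ==> (p j == q j)].
have agreeP t (q p : {perm 'I_n}) : reflect (forall j, q j < t -> p j = q j) (agree t q p).
  apply: (iffP forallP) => h j; first by move=> qj; apply/eqP/(implyP (h j)).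
  by apply/implyP => /h/eqP.
(* Induction on the number [k] of persons still to be placed: the first [t] sit as in [q], and the
   valid [p] extending this are counted. *)
suff main k t (q : {perm 'I_n}) : t + k = n ->
    (forall j, q j < t -> R (occupied_before q (q j)) j) ->
  #|[set p | V p & agree t q p]| = C [set j | q j < t].
  have <- : [set j | (1%g : {perm 'I_n}) j < 0] = set0 by apply/setP=> j; rewrite !inE.
  rewrite -(main n) //; apply: eq_card => p; rewrite !inE -/(V p).
  by case: (V p) => //=; symmetry; apply/agreeP.
elim: k t q => [|k IHk] t q tk Rq.
  have lt_t (j : 'I_n) : j < t by rewrite -(addn0 t) tk.
  have -> : [set j | q j < t] = setT by apply/setP=> j; rewrite !inE lt_t.
  rewrite CT; apply/eqP/cards1P; exists q; apply/setP => p; rewrite !inE.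
  apply/andP/eqP => [[_ /agreeP qp]|->]; first by apply/permP => j; apply: qp.
  by split; [apply/forallP => j; apply: Rq | apply/agreeP].
have t_lt : t < n by rewrite -tk -addSnnS leq_addr.
pose tt := Ordinal t_lt.
set A := [set j | q j < t].
have A_neq : A != setT.
  apply/eqP => /setP/(_ ((q^-1)%g tt)).
  by rewrite !inE permKV ltnn.
rewrite CS // -sum1_card (partition_big (fun p : {perm 'I_n} => (p^-1)%g tt) xpredT) //=.
rewrite [RHS]big_mkcond; apply: eq_bigr => x _.
have occA (p : {perm 'I_n}) y : agree t q p -> p y = tt -> occupied_before p (p y) = A.
  move=> /agreeP qp py; apply/setP => j.
  by rewrite !inE py /=; apply: occupied_before_agree.
case: ifPn => Rx; last first.
  rewrite big1 // => p; rewrite inE => /andP[/andP[/forallP Vp qp] /eqP px].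
  have {}px : p x = tt by rewrite -px permKV.
  by have := Vp x; rewrite (occA _ _ qp px) (negPf Rx).
have xA := RA _ _ Rx; have t_le : t <= q x by rewrite leqNgt; move: xA; rewrite inE.
(* [r] keeps the first [t] persons of [q] and exchanges person [t] with the occupant of [x]; it is
   the reference permutation for [t.+1]. *)
pose r : {perm 'I_n} := (q * tperm (q x) tt)%g.
have rx : r x = tt by rewrite permM tpermL.
have rq j : q j < t -> r j = q j.
  move=> qj; rewrite permM tpermD //; apply/negP => /eqP e.
    by move: qj; rewrite -e ltnNge t_le.
  by move: qj; rewrite -e ltnn.
have rS j : (r j < t.+1) = (j == x) || (q j < t).
  rewrite -(occupied_before_agree n r q t rq) ltnS leq_eqVlt; congr (_ || _).
  apply/eqP/eqP => [e|->]; last by rewrite rx.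
  by apply: (@perm_inj _ r); apply/val_inj; rewrite /= e rx.
have AS : x |: A = [set j | r j < t.+1] by apply/setP => j; rewrite !inE rS.
rewrite AS -(IHk t.+1 r); first last.
- move=> j; rewrite rS => /predU1P[->|qj].
    rewrite (occA r) //; by apply/agreeP => i; apply: rq.
  rewrite (_ : occupied_before r (r j) = occupied_before q (q j)); first exact: Rq.
  apply/setP => i; rewrite !inE (rq j) //; apply: occupied_before_agree => l ql.
  by apply: rq; apply: ltn_trans qj.
- by rewrite addSnnS.
rewrite sum1_card; apply: eq_card => p; rewrite inE unfold_in inE -andbA.
case: (V p) => //=.
apply/andP/agreeP => [[/agreeP qp /eqP px] j|rp].
  rewrite rS => /predU1P[->|qj]; first by rewrite rx -px permKV.
  by rewrite rq // qp.
split; first by apply/agreeP => j qj; rewrite rp ?rS ?qj ?orbT // rq.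
by rewrite -rx -(rp x) ?permK // rS eqxx.
Qed.

(** * Effect of one element on [G], and the top elements of S(m) and S'(l) *)

Lemma gapS_gt n v : n < v -> gapS n v = 0.
Proof.
elim/ltn_ind: n v => -[|m] IH v mv; first by rewrite gapS0 mset0E.
rewrite gapS_succ !msetE2 !msetnE !IH; try lia.
by case: eqP => //; lia.
Qed.

(* No doubling for m = 2: the two optimal payphones of a gap of length 2 are
   already counted by the two elements of S(2) = {2, 1}. *)
Definition even_factor m := if ~~ odd m && (2 < m) then 2 else 1.

(** Adding [m] turns c! into (c+1)! at level [uphalf m] only, and raises the exponent of 2 exactly
    when [m] is even and above 2. *)
Lemma G_mset1D m (M : {mset nat}) : 0 < m ->
  G (m +` M) = G M * ((M (2 * uphalf m) + M (2 * uphalf m - 1)).+1 * even_factor m).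
Proof.
move=> m0; set k := uphalf m.
pose N := maxn (mset_max (m +` M)) (maxn (mset_max M) k.+1).
rewrite (@G_bound (m +` M) N) ?leq_maxl // (@G_bound M N); last by rewrite /N; lia.
have kN : k < N by rewrite /N; lia.
have k0 : 0 < k by rewrite /k; lia.
rewrite mulnACA; congr (_ * _).
  rewrite (bigD1_seq k) ?iota_uniq ?mem_index_iota ?k0 //=; last lia.
  rewrite [in RHS](bigD1_seq k) ?iota_uniq ?mem_index_iota ?k0 //=; last lia.
  rewrite mulnAC; congr (_ * _).
    have -> : (m +` M) (2 * k) + (m +` M) (2 * k - 1) = (M (2 * k) + M (2 * k - 1)).+1.
      by rewrite !msetE2 !msetnE; do 2 case: eqP; lia.
    by rewrite factS mulnC.
  rewrite big_seq_cond [RHS]big_seq_cond; apply: eq_bigr => i.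
  rewrite mem_index_iota => /andP[i_gt i_neq].
  by rewrite !msetE2 !msetnE; do 2 (case: eqP; first lia).
rewrite /even_factor; case: ifPn => m2; last first.
  rewrite muln1; congr (2 ^ _); rewrite big_seq_cond [RHS]big_seq_cond.
  apply: eq_bigr => i; rewrite mem_index_iota => i_gt.
  by rewrite !msetE2 !msetnE; case: eqP => //; lia.
have mk : m = 2 * k.
  have := odd_double_half m; move: m2 => /andP[/negPf mo _].
  by rewrite /k uphalf_half mo; lia.
rewrite mulnC -expnS; congr (2 ^ _).
rewrite (bigD1_seq k) ?iota_uniq ?mem_index_iota //=; last lia.
rewrite [in RHS](bigD1_seq k) ?iota_uniq ?mem_index_iota //=; last lia.
rewrite -addSn; congr (_ + _).
  by rewrite !msetE2 !msetnE -mk eqxx add1n.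
rewrite big_seq_cond [RHS]big_seq_cond; apply: eq_bigr => i.
rewrite mem_index_iota => i_gt.
by rewrite !msetE2 !msetnE; case: eqP => //; lia.
Qed.
Definition pair_count (k : nat) (M : {mset nat}) := M (2 * k) + M (2 * k - 1).

Lemma pair_countD k M M' : pair_count k (M `+` M') = pair_count k M + pair_count k M'.
Proof. by rewrite /pair_count !msetE2 addnACA. Qed.

Lemma pair_count1 k m : 0 < k -> 0 < m -> pair_count k [mset m] = (uphalf m == k).
Proof.
move=> k0 m0; rewrite /pair_count !msetnE.
by have [e|ne] := eqVneq (uphalf m) k; do 2 (case: eqP => ?) => /=; lia.
Qed.

(** Elements of S(m) other than the head m lie below level [k], except for m = 2 and k = 1: both
    elements of S(2) = {2, 1} have level 1. *)
Lemma gapS_pair_count k m : 0 < k -> uphalf m <= k ->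
  pair_count k (gapS m) = (uphalf m == k) * (if m == 2 then 2 else 1).
Proof.
move=> k0; case: m => [|m] mk.
  by rewrite /pair_count gapS0 !mset0E; case: eqP => //=; lia.
rewrite gapS_succ !pair_countD pair_count1 //.
have [->|m1] := eqVneq m 1.
  rewrite (gapS_succ 0) !pair_countD /= !gapS0 pair_count1 //.
  by rewrite /pair_count !mset0E; case: k mk k0 => [|[|k]].
rewrite /pair_count !gapS_gt; try lia.
by rewrite (negPf (_ : m.+1 != 2)) ?muln1 ?addn0.
Qed.

Lemma gapS'_pair_count k l : 0 < k -> l <= k -> pair_count k (gapS' l) = (l == k).
Proof.
move=> k0; case: l => [|l] lk.
  by rewrite /gapS' /pair_count !mset0E; case: eqP => //=; lia.
have -> : gapS' l.+1 = gapS l `+` [mset (2 * l.+1).-1] by [].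
rewrite pair_countD pair_count1 //; last lia.
by rewrite /pair_count !gapS_gt; lia.
Qed.

(** * A single gap: its multiset, head, level and optimal payphones *)

(* Coordinates of gaps are shifted: payphone c sits at c.+1, and 0 and n.+1 are
   permanently occupied sentinels, so that every empty payphone lies strictly
   between two consecutive occupied places i < j. *)
Definition occ {n} (A : {set 'I_n}) (x : nat) : bool :=
  [|| x == 0, x == n.+1 | [exists c in A, c.+1 == x]].

Definition gap {n} (A : {set 'I_n}) (i j : nat) : bool :=
  [&& occ A i, occ A j, i < j & [forall x : 'I_n.+2, (i < x < j) ==> ~~ occ A x]].

Definition boundary (n i j : nat) : bool := (i == 0) || (j == n.+1).

Definition gap_mset n i j : {mset nat} :=
  if boundary n i j then gapS' (j - i).-1 else gapS (j - i).-1.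

Definition gap_head n i j : nat :=
  if boundary n i j then (2 * (j - i).-1).-1 else (j - i).-1.

(** The best distance that the gap offers: its length at a boundary, half its length rounded up
    inside. *)
Definition gap_level n i j : nat := uphalf (gap_head n i j).

Definition gap_dist n i j x : nat :=
  if i == 0 then j - x else if j == n.+1 then x - i else minn (x - i) (j - x).

(** In a boundary gap the optimal place is next to the sentinel and leaves S(l - 1) out of S'(l). In
    an inner gap it is central and reproduces the recursion of S. Either way just the head
    disappears. *)
Lemma gap_msetE n i j x : i < x < j -> j <= n.+1 -> ~~ ((i == 0) && (j == n.+1)) ->
  gap_dist n i j x = gap_level n i j ->
  gap_mset n i j = [mset gap_head n i j] `+` (gap_mset n i x `+` gap_mset n x j).
Proof.
move=> ixj jn nb; rewrite /gap_level /gap_dist /gap_mset /gap_head /boundary.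
have xn : (x == n.+1) = false by apply/eqP; lia.
have x0 : (x == 0) = false by apply/eqP; lia.
rewrite xn x0 /=; have [i0|i0] /= := eqVneq i 0.
  have jn' : (j == n.+1) = false by move: nb; rewrite i0 /= => /negPf.
  rewrite i0 jn' subn0 => e; have -> : x = 1 by lia.
  rewrite [gapS' (_ - _).-1]/gapS' /= mset0D /gapS'.
  case: eqP => [|_]; first lia.
  by rewrite msetDC; congr (_ `+` gapS _); lia.
have [jn'|jn'] /= := eqVneq j n.+1.
  move=> e; have -> : x = j.-1 by lia.
  rewrite [gapS' (j - _).-1]/gapS' [gapS' (j - j.-1).-1]/gapS'.
  case: eqP => [|_]; first lia.
  case: eqP => [_|]; last lia.
  by rewrite msetD0 msetDC; congr (_ `+` gapS _); lia.
move=> e; have -> : (j - i).-1 = ((x - i).-1 + (j - x).-1).+1 by lia.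
rewrite gapS_succ -msetDA; congr (_ `+` _).
(* For even length there are two central places, so the shorter half may lie on either side. *)
have [le|lt] := leqP (x - i) (j - x); last rewrite msetDC.
  by congr (gapS _ `+` gapS _); lia.
by congr (gapS _ `+` gapS _); lia.
Qed.

Lemma gap_dist_le n i j x : i < x < j -> j <= n.+1 -> ~~ ((i == 0) && (j == n.+1)) ->
  gap_dist n i j x <= gap_level n i j.
Proof.
rewrite /gap_level /gap_dist /gap_head /boundary => ixj jn.
by have [i0|i0] /= := eqVneq i 0; have [->|j0] /= := eqVneq j n.+1 => //= _; lia.
Qed.

Lemma gap_dist_attained n i j : j <= n.+1 -> ~~ ((i == 0) && (j == n.+1)) ->
  0 < gap_level n i j -> exists2 x, i < x < j & gap_dist n i j x = gap_level n i j.
Proof.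
rewrite /gap_level /gap_dist /gap_head /boundary => jn.
have [i0|i0] /= := eqVneq i 0; have [j0|j0] /= := eqVneq j n.+1 => //= _ l0.
- by exists 1; lia.
- by exists j.-1; lia.
- by exists (i + uphalf (j - i).-1); lia.
Qed.

(** At level [k], a boundary gap has one optimal payphone and an odd head. An inner gap has one for
    odd length and two for even length; the 2 comes from [even_factor], or from the pair count when
    the length is 2. Below level [k] both sides are 0. *)
Lemma card_gap_choices n i j k : i < j <= n.+1 -> ~~ ((i == 0) && (j == n.+1)) ->
  0 < k -> gap_level n i j <= k ->
  #|[set x : 'I_n | (i < x.+1 < j) && (gap_dist n i j x.+1 == k)]| =
    pair_count k (gap_mset n i j) * even_factor (gap_head n i j).
Proof.
move=> /andP[ij jn] nb k0 lk.
have [lt|lt|lev] := ltngtP (gap_level n i j) k; last 1 first.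
- have pick a : i < a < j -> {x : 'I_n | x.+1 = a}.
    by move=> ia; have lt : a.-1 < n by [lia]; exists (Ordinal lt) => /=; lia.
  have one a : i < a < j -> (forall x, i < x < j -> (gap_dist n i j x == k) = (x == a)) ->
      #|[set x : 'I_n | (i < x.+1 < j) && (gap_dist n i j x.+1 == k)]| = 1.
    move=> ia da; have [x xa] := pick a ia; rewrite -(cards1 x); apply: eq_card => y.
    rewrite !inE -val_eqE /=; case: (boolP (i < y.+1 < j)) => [/da ->|] /=; lia.
  move: lev; rewrite /gap_level /gap_mset /gap_head.
  case: ifP => bd lev.
    rewrite gapS'_pair_count; [|by []|lia].
    have -> : (j - i).-1 == k by lia.
    rewrite /even_factor (_ : odd _); last by lia.
    move: bd nb; rewrite muln1 /boundary; case: eqVneq => [i0|i0] /= bd nb.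
      by apply: (one (j - k)) => [|x]; rewrite /gap_dist i0 /=; lia.
    by apply: (one (i + k)) => [|x]; rewrite ?/gap_dist ?(negPf i0) ?bd /=; lia.
  move/negbT: bd; rewrite /boundary negb_or => /andP[/negPf i0 /negPf jn0].
  rewrite gapS_pair_count ?lev // eqxx mul1n.
  have [odd_m|even_m] := boolP (odd (j - i).-1).
    rewrite /even_factor odd_m /= (_ : (_ == 2) = false); last by lia.
    by apply: (one (i + k)) => [|x]; rewrite /gap_dist ?i0 ?jn0; lia.
  (* The gap has length 2k, with central places i + k and i + k + 1. *)
  have [x xa] : {x : 'I_n | x.+1 = i + k} by apply: pick; lia.
  have [y yb] : {y : 'I_n | y.+1 = (i + k).+1} by apply: pick; lia.
  have -> : [set x : 'I_n | (i < x.+1 < j) && (gap_dist n i j x.+1 == k)] = [set x; y].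
    by apply/setP => z; rewrite !inE -!val_eqE /= /gap_dist i0 jn0; lia.
  rewrite cards2 -val_eqE /even_factor even_m /=.
  have -> : (x != y :> nat) by lia.
  by case: eqVneq => [->//|m2]; rewrite (_ : 2 < _) //; lia.
- rewrite (_ : [set x | _] = set0) ?cards0; last first.
    apply/setP => x; rewrite !inE; apply/negP => /andP[ix /eqP d].
    by have := gap_dist_le n i j x.+1 ix jn nb; lia.
  symmetry; apply/eqP; rewrite muln_eq0; apply/orP; left; apply/eqP.
  move: lt; rewrite /gap_level /gap_mset /gap_head; case: ifP => _ lt.
    by rewrite gapS'_pair_count //; [case: eqP => //; lia | lia].
  by rewrite gapS_pair_count // ?(ltnW lt) // (ltn_eqF lt).
- by move: lk; rewrite leqNgt lt.
Qed.

(** * Occupied places, and how a new person changes the gaps *)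

Lemma occ_bound n (A : {set 'I_n}) x : occ A x -> x <= n.+1.
Proof.
by case/or3P => [/eqP->|/eqP->|/existsP[c /andP[_ /eqP <-]]] //; rewrite ltnW // ltnS.
Qed.

Lemma occ_cell n (A : {set 'I_n}) (c : 'I_n) : occ A c.+1 = (c \in A).
Proof.
rewrite /occ /= eqSS ltn_eqF //=; apply/existsP/idP => [[d /andP[dA]]|cA].
  by rewrite eqSS => /eqP/val_inj <-.
by exists c; rewrite cA eqxx.
Qed.

Lemma occ_setU1 n (A : {set 'I_n}) (c : 'I_n) x :
  occ (c |: A) x = (x == c.+1) || occ A x.
Proof.
rewrite /occ; case: (x =P c.+1) => [->|ne].
  rewrite (_ : [exists d in c |: A, d.+1 == c.+1]) ?orbT //.
  by apply/existsP; exists c; rewrite !inE !eqxx.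
congr [|| _, _ | _]; apply: eq_existsb => d; rewrite !inE andb_orl.
by case: (eqVneq d c) => [->|//] /=; case: eqP => //= e; case: ne.
Qed.

Lemma gapP n (A : {set 'I_n}) i j :
  reflect [/\ occ A i, occ A j, i < j & forall x, i < x < j -> ~~ occ A x] (gap A i j).
Proof.
apply: (iffP and4P) => -[Ai Aj ij E]; split=> //.
  move=> x ixj; have xn : x < n.+2 by have := occ_bound _ _ _ Aj; lia.
  by have /forallP/(_ (Ordinal xn))/implyP := E; apply.
by apply/forallP => x; apply/implyP; apply: E.
Qed.

(** The sentinels guarantee an occupied place on each side; the nearest ones bound the gap. *)
Lemma gap_around n (A : {set 'I_n}) (c : 'I_n) : c \notin A ->
  exists p : 'I_n.+2 * 'I_n.+2, gap A p.1 p.2 && (p.1 < c.+1 < p.2).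
Proof.
move=> cA.
have exl : exists i, occ A i && (i < c.+1) by exists 0.
have exr : exists j, occ A j && (c.+1 < j) by exists n.+1; rewrite /occ eqxx orbT ltnS /=.
have [i /andP[Ai ic] imax] := ex_maxnP exl (fun i h => ltnW (proj2 (andP h))).
have [j /andP[Aj cj] jmin] := ex_minnP exr.
have lti : i < n.+2 by have := occ_bound _ _ _ Ai.
have ltj : j < n.+2 by have := occ_bound _ _ _ Aj.
exists (Ordinal lti, Ordinal ltj); rewrite /= ic cj !andbT; apply/gapP; split=> //.
  exact: ltn_trans cj.
move=> x /andP[ix xj]; apply/negP => Ax; have [xc|xc|e] := ltngtP x c.+1.
- by have := imax x; rewrite Ax xc => /(_ isT); rewrite leqNgt ix.
- by have := jmin x; rewrite Ax xc => /(_ isT); rewrite leqNgt xj.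
- by move: cA; rewrite -occ_cell -e Ax.
Qed.

Lemma gap_unique n (A : {set 'I_n}) i j i' j' x :
  gap A i j -> gap A i' j' -> i < x < j -> i' < x < j' -> i = i' /\ j = j'.
Proof.
move=> /gapP[Ai Aj ij E] /gapP[Ai' Aj' ij' E'] xi xi'.
have {}E y : occ A y -> ~~ (i < y < j) by move=> Ay; apply/negP => /E; rewrite Ay.
have {}E' y : occ A y -> ~~ (i' < y < j') by move=> Ay; apply/negP => /E'; rewrite Ay.
by have := E _ Ai'; have := E _ Aj'; have := E' _ Ai; have := E' _ Aj; lia.
Qed.

Lemma gap_setU1 n (A : {set 'I_n}) (c : 'I_n) i j u v :
  gap A i j -> i < c.+1 < j ->
  gap (c |: A) u v = [|| gap A u v && ~~ ((u == i) && (v == j)),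
                         (u == i) && (v == c.+1) | (u == c.+1) && (v == j)].
Proof.
move=> g; move: (g) => /gapP[Ai Aj ij E] icj.
have Ac : ~~ occ A c.+1 by apply: E.
have {}E y : occ A y -> ~~ (i < y < j) by move=> Ay; apply/negP => /E; rewrite Ay.
apply/idP/idP.
  move=> /gapP[]; rewrite !occ_setU1 => Au Av uv E'.
  have F y : occ A y -> ~~ (u < y < v).
    by move=> Ay; apply/negP => /E'; rewrite occ_setU1 Ay orbT.
  have Ec : ~~ (u < c.+1 < v) by apply/negP => /E'; rewrite occ_setU1 eqxx.
  have Ei := F _ Ai; have Ej := F _ Aj.
  (* If neither end is the place of [c], the pair was already a gap, and not [(i, j)], which now
     contains [c]. *)
  have [uc|uc] := eqVneq u c.+1.
    have Av' : occ A v by move: Av; case: eqP => //=; lia.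
    by have := E _ Av'; lia.
  have Au' : occ A u by move: Au; rewrite (negPf uc).
  have [vc|vc] := eqVneq v c.+1.
    by have := E _ Au'; lia.
  have Av' : occ A v by move: Av; rewrite (negPf vc).
  rewrite (_ : gap A u v); first by have := E _ Au'; have := E _ Av'; lia.
  by apply/gapP; split=> // x /E'; rewrite occ_setU1 negb_or => /andP[].
have Ec x : occ A x -> x != c.+1 by apply: contraTneq => ->.
case/or3P.
- move=> /andP[/gapP[Au Av uv E'] nij].
  apply/gapP; split=> //; rewrite ?occ_setU1 ?Au ?Av ?orbT //.
  move=> x ux; rewrite occ_setU1 negb_or E' // andbT.
  have {}E' y : occ A y -> ~~ (u < y < v) by move=> Ay; apply/negP => /E'; rewrite Ay.
  have := E _ Au; have := E _ Av; have := E' _ Ai; have := E' _ Aj.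
  by have := Ec _ Au; have := Ec _ Av; lia.
- move=> /andP[/eqP-> /eqP->].
  apply/gapP; rewrite !occ_setU1 Ai eqxx orbT; split=> //; first lia.
  move=> x ix; rewrite occ_setU1 negb_or; apply/andP; split; first lia.
  by apply/negP => /E; lia.
- move=> /andP[/eqP-> /eqP->].
  apply/gapP; rewrite !occ_setU1 Aj eqxx orbT; split=> //; first lia.
  move=> x ix; rewrite occ_setU1 negb_or; apply/andP; split; first lia.
  by apply/negP => /E; lia.
Qed.

(** * The multiset of all gaps *)

HB.instance Definition _ := Monoid.isComLaw.Build {mset nat} mset0 (@msetD nat)
  (@msetDA _) (@msetDC _) (@mset0D _).

(** This is M(A); neighbouring occupied places form gaps of length 0, which contribute nothing. *)
Definition gaps_mset {n} (A : {set 'I_n}) : {mset nat} :=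
  \big[@msetD nat/mset0]_(p : 'I_n.+2 * 'I_n.+2 | gap A p.1 p.2) gap_mset n p.1 p.2.

(** The common remainder [M] gathers the untouched gaps, which avoids subtracting multisets. *)
Lemma gaps_mset_setU1 n (A : {set 'I_n}) (c : 'I_n) (i j : 'I_n.+2) :
  gap A i j -> i < c.+1 < j ->
  exists2 M, gaps_mset A = gap_mset n i j `+` M
           & gaps_mset (c |: A) = gap_mset n i c.+1 `+` gap_mset n c.+1 j `+` M.
Proof.
move=> g icj; have cn : c.+1 < n.+2 by rewrite !ltnS ltnW.
pose x := Ordinal cn; have gE := gap_setU1 n A c i j _ _ g icj.
exists (\big[@msetD nat/mset0]_(p : 'I_n.+2 * 'I_n.+2 | gap A p.1 p.2 && (p != (i, j)))
   gap_mset n p.1 p.2); first by rewrite /gaps_mset (bigD1 (i, j) g).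
rewrite /gaps_mset (bigD1 (i, x)) /=; last by rewrite gE !eqxx orbT.
rewrite (bigD1 (x, j)) /=; last first.
  by rewrite gE !eqxx !orbT /= xpair_eqE -!val_eqE /=; lia.
rewrite msetDA; congr (_ `+` _); apply: eq_bigl => -[u v] /=.
rewrite gE !xpair_eqE -!val_eqE /=.
case: (boolP (gap A u v)) => [/gapP[Au Av _ _]|_] /=; last by lia.
have Ac : ~~ occ A c.+1 by move/gapP: g => [_ _ _]; apply.
have Ec y : occ A y -> y != c.+1 by apply: contraTneq => ->.
by have := Ec _ Au; have := Ec _ Av; lia.
Qed.

(** * Distances to occupied payphones and rule (P1) *)

Lemma distnE (a b : nat) : `|a - b|%N = (a - b) + (b - a).
Proof. lia. Qed.

Lemma bigminn_eq (I : finType) (P : pred I) (F : I -> nat) n d :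
  d <= n -> (forall i, P i -> d <= F i) -> (exists2 i, P i & F i = d) ->
  \big[minn/n]_(i | P i) F i = d.
Proof.
move=> dn dF [i Pi Fi]; apply/eqP; rewrite eqn_leq; apply/andP; split.
  have := mem_index_enum i; elim: (index_enum I) => // a s IHs.
  rewrite inE big_cons => /predU1P[<-|/IHs le]; first by rewrite Pi -Fi geq_minl.
  by case: ifP => _ //; apply: leq_trans (geq_minr _ _) le.
by elim/big_ind: _ => // x y dx dy; rewrite leq_min dx.
Qed.

Lemma sentinel_gap n (A : {set 'I_n}) i j :
  A != set0 -> gap A i j -> ~~ ((i == 0) && (j == n.+1)).
Proof.
case/set0Pn => c cA /gapP[_ _ _ E]; apply/negP => /andP[/eqP i0 /eqP jn].
by have := E c.+1; rewrite i0 jn /= ltnS ltn_ord occ_cell cA => /(_ isT).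
Qed.

(** No occupied payphone lies inside the gap, so a nearest one sits at an end that is not a
    sentinel. *)
Lemma dist_occE n (A : {set 'I_n}) (x : 'I_n) i j :
  A != set0 -> gap A i j -> i < x.+1 < j -> dist_occ x A = gap_dist n i j x.+1.
Proof.
move=> A0 g ixj; have := sentinel_gap _ _ _ _ A0 g.
move: g => /gapP[Ai Aj ij E] nb.
have jn := occ_bound _ _ _ Aj.
have F (a : 'I_n) : a \in A -> ~~ (i < a.+1 < j).
  by rewrite -occ_cell => Aa; apply/negP => /E; rewrite Aa.
have cell y : occ A y -> 0 < y <= n -> {a : 'I_n | a \in A & a.+1 = y}.
  move=> Ay yn; have lt : y.-1 < n by lia.
  by exists (Ordinal lt); rewrite -?occ_cell /= prednK //; lia.
apply: bigminn_eq.
(* The default value [n] of the minimum must not undercut the distance. *)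
- by rewrite /gap_dist; case: ifP => ?; try (case: ifP => ?); lia.
- by move=> a /F; have := ltn_ord a; rewrite distnE /gap_dist; case: ifP => ?; try (case: ifP => ?); lia.
- rewrite /gap_dist; case: (eqVneq i 0) nb => [i0|i0] /= nb.
    by have [|a aA ae] := cell _ Aj; [lia | exists a => //; rewrite distnE; lia].
  case: (eqVneq j n.+1) => [j0|j0].
    by have [|a aA ae] := cell _ Ai; [lia | exists a => //; rewrite distnE; lia].
  have [a aA ae] : {a : 'I_n | a \in A & a.+1 = i} by apply: cell => //; lia.
  have [b bA be] : {b : 'I_n | b \in A & b.+1 = j} by apply: cell => //; lia.
  have [le|lt] := leqP (x.+1 - i) (j - x.+1); first by exists a => //; rewrite distnE; lia.
  by exists b => //; rewrite distnE; lia.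
Qed.

Definition max_dist {n} (A : {set 'I_n}) : nat := \max_(x | x \notin A) dist_occ x A.

Lemma dist_le_max n (A : {set 'I_n}) x : x \notin A -> dist_occ x A <= max_dist A.
Proof. by move=> xA; apply: leq_bigmax_cond. Qed.

Lemma P1_choiceE n (A : {set 'I_n}) x : A != set0 ->
  P1_choice A x = (x \notin A) && (dist_occ x A == max_dist A).
Proof.
move=> /negPf A0; rewrite /P1_choice A0 /=; case: (boolP (x \in A)) => //= xA.
apply/forallP/eqP => [h|-> y].
  apply/eqP; rewrite eqn_leq dist_le_max //=.
  by apply/bigmax_leqP => y yA; apply: (implyP (h y)).
by apply/implyP => yA; apply: dist_le_max.
Qed.

Lemma max_dist_gt0 n (A : {set 'I_n}) : A != set0 -> A != setT -> 0 < max_dist A.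
Proof.
move=> A0 AT; have [x xA] : exists x, x \notin A.
  by have := AT; rewrite -subTset => /subsetPn[x _ xA]; exists x.
have [p /andP[g ixj]] := gap_around _ _ _ xA.
apply: leq_trans (dist_le_max _ _ _ xA); rewrite (dist_occE _ _ _ _ _ A0 g ixj).
by have := sentinel_gap _ _ _ _ A0 g; rewrite /gap_dist; case: ifP => ?; try (case: ifP => ?); lia.
Qed.

(** A positive level is the distance of some empty payphone in the gap. *)
Lemma gap_level_le n (A : {set 'I_n}) i j :
  A != set0 -> gap A i j -> gap_level n i j <= max_dist A.
Proof.
move=> A0 g; have [->//|l0] := posnP (gap_level n i j).
move: (g) => /gapP[_ Aj _ E]; have jn := occ_bound _ _ _ Aj.
have nb := sentinel_gap _ _ _ _ A0 g.
have [[|x] ixj <-] := gap_dist_attained _ _ _ jn nb l0; first by lia.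
have xn : x < n by lia.
rewrite -(dist_occE _ _ (Ordinal xn) _ _ A0 g ixj); apply: dist_le_max.
by rewrite -occ_cell; apply: E.
Qed.

Lemma gaps_mset_choice n (A : {set 'I_n}) (x : 'I_n) (i j : 'I_n.+2) :
  A != set0 -> gap A i j -> i < x.+1 < j -> P1_choice A x ->
  gap_level n i j = max_dist A /\
  gaps_mset A = [mset gap_head n i j] `+` gaps_mset (x |: A).
Proof.
move=> A0 g ixj; rewrite P1_choiceE // (dist_occE _ _ _ _ _ A0 g ixj) => /andP[_ /eqP d].
have nb := sentinel_gap _ _ _ _ A0 g.
have jn : j <= n.+1 by case/gapP: g => _ /occ_bound.
have le := gap_level_le _ _ _ _ A0 g.
have ge := gap_dist_le _ _ _ _ ixj jn nb.
(* The distance of [x] is maximal and at most the level, while the level is at most the maximum. *)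
have lE : gap_level n i j = max_dist A by apply/eqP; rewrite eqn_leq le -d ge.
split=> //; have [M -> ->] := gaps_mset_setU1 _ _ _ _ _ g ixj.
by rewrite (gap_msetE _ _ _ _ ixj) ?d // !msetDA.
Qed.

(** * Double counting of the admissible choices *)

Lemma pair_count_gaps n (A : {set 'I_n}) k :
  pair_count k (gaps_mset A) =
    \sum_(p : 'I_n.+2 * 'I_n.+2 | gap A p.1 p.2) pair_count k (gap_mset n p.1 p.2).
Proof.
apply: (big_morph (pair_count k)) => [M M'|]; first exact: pair_countD.
by rewrite /pair_count !mset0E.
Qed.

(** Every empty payphone lies in exactly one gap. *)
Lemma sum_empty_by_gap n (A : {set 'I_n}) (P : pred 'I_n) (F : 'I_n -> nat) :
  (forall x, P x -> x \notin A) ->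
  \sum_(x | P x) F x = \sum_(p : 'I_n.+2 * 'I_n.+2 | gap A p.1 p.2)
                         \sum_(x | P x && (p.1 < x.+1 < p.2)) F x.
Proof.
move=> PA; rewrite (exchange_big_dep P) /=; last by move=> p x _ /andP[].
apply: eq_bigr => x Px; have [p /andP[g ixj]] := gap_around _ _ _ (PA _ Px).
rewrite (big_pred1 p) // => q; rewrite Px /=.
apply/idP/eqP => [/andP[gq ixjq]|->]; last by rewrite g.
have [e1 e2] := gap_unique _ _ _ _ _ _ _ gq g ixjq ixj.
by case: p q e1 e2 {g ixj gq ixjq} => [p1 p2] [q1 q2] /= /val_inj-> /val_inj->.
Qed.

Lemma G_gaps_mset_step n (A : {set 'I_n}) : A != set0 -> A != setT ->
  G (gaps_mset A) = \sum_(x | P1_choice A x) G (gaps_mset (x |: A)).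
Proof.
move=> A0 AT; set k := max_dist A; set N := pair_count k (gaps_mset A).
have k0 : 0 < k := max_dist_gt0 _ _ A0 AT.
have chA x : P1_choice A x -> x \notin A by case/andP.
(* A choice in the gap [p] removes its head, of top level [k], so [G] loses the factor [N] times the
   [even_factor] of that head. *)
have step (x : 'I_n) (p : 'I_n.+2 * 'I_n.+2) :
    gap A p.1 p.2 -> p.1 < x.+1 < p.2 -> P1_choice A x ->
    0 < N /\ even_factor (gap_head n p.1 p.2) * (N * G (gaps_mset (x |: A))) = G (gaps_mset A).
  move=> g ixj ch; have [lE mE] := gaps_mset_choice _ _ _ _ _ A0 g ixj ch.
  have h0 : 0 < gap_head n p.1 p.2 by move: lE k0; rewrite /gap_level -/k; lia.
  have NE : N = (pair_count k (gaps_mset (x |: A))).+1.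
    by rewrite /N mE pair_countD pair_count1 // -/(gap_level _ _ _) lE eqxx.
  rewrite [in RHS]mE G_mset1D // -/(gap_level _ _ _) lE -/k -/(pair_count _ _) -NE.
  by split; lia.
(* As [A] is not full, some empty payphone attains the maximal distance; [step] applied to it gives
   positivity. *)
have N0 : 0 < N.
  have [x ch] : exists x, P1_choice A x.
    have [y yA] : exists y, y \notin A.
      by have := AT; rewrite -subTset => /subsetPn[y _ yA]; exists y.
    have : 0 < #|[pred y | y \notin A]| by apply/card_gt0P; exists y.
    move=> /(eq_bigmax_cond (fun z : 'I_n => dist_occ z A))[x]; rewrite inE => xA xmax.
    by exists x; rewrite P1_choiceE // xA /k /max_dist -xmax /=.
  by have [p /andP[g ixj]] := gap_around _ _ _ (chA _ ch); case: (step x p g ixj ch).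
(* Both sides are multiplied by [N], which on the left is expanded as a sum of pair counts over the
   gaps; the comparison is then made gap by gap. *)
apply/eqP; rewrite -(eqn_pmul2l N0) big_distrr /= (sum_empty_by_gap _ _ _ _ chA).
rewrite {1}/N pair_count_gaps big_distrl /=; apply/eqP; apply: eq_bigr => p g.
have nb := sentinel_gap _ _ _ _ A0 g.
have jn : p.1 < p.2 <= n.+1 by case/gapP: g => _ /occ_bound -> ->.
have := card_gap_choices _ _ _ _ jn nb k0 (gap_level_le _ _ _ _ A0 g).
set c := #|_| => cE.
have c0 : 0 < even_factor (gap_head n p.1 p.2) by rewrite /even_factor; case: ifP.
(* Multiplying by [even_factor] makes the left coefficient the number of optimal payphones in [p]
   and each right summand equal to [G (gaps_mset A)]. *)
apply/eqP; rewrite -(eqn_pmul2l c0) mulnA [even_factor _ * pair_count _ _]mulnC -cE.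
rewrite big_distrr /=; apply/eqP.
rewrite (eq_bigr (fun=> G (gaps_mset A))); last first.
  by move=> x /andP[ch ixj]; case: (step x p g ixj ch).
rewrite sum_nat_const; congr (_ * _); apply: eq_card => x; rewrite inE unfold_in andbC.
case: (boolP (p.1 < x.+1 < p.2)) => [ixj|]; last by rewrite !andbF.
rewrite !andbT P1_choiceE // (dist_occE _ _ _ _ _ A0 g ixj).
by rewrite -occ_cell; case/gapP: g => _ _ _ ->.
Qed.

(** * One occupied payphone, the full row, and the final sum *)

Lemma gaps_mset1 n (x : 'I_n) : gaps_mset [set x] = gapS' x `+` gapS' (n - x.+1).
Proof.
have n0 : 0 < n by apply: leq_ltn_trans (ltn_ord x).
have oE y : occ (set0 : {set 'I_n}) y = (y == 0) || (y == n.+1).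
  rewrite /occ; case: existsP => [[c]|_]; last by rewrite orbF.
  by rewrite inE.
have gE i j : gap (set0 : {set 'I_n}) i j = (i == 0) && (j == n.+1).
  apply/gapP/idP => [[]|/andP[/eqP-> /eqP->]]; first by rewrite !oE; lia.
  by split=> [|||y]; rewrite ?oE ?eqxx ?orbT //; lia.
have g : gap (set0 : {set 'I_n}) (ord0 : 'I_n.+2) (ord_max : 'I_n.+2) by rewrite gE /= !eqxx.
(* The first person splits the only gap, the one between the sentinels, so the remainder [M] will be
   empty. *)
have [|M] := @gaps_mset_setU1 n set0 x _ _ g; first by rewrite /= ltnS ltn_ord.
rewrite setU0 {1}/gaps_mset (big_pred1 (ord0, ord_max)); last first.
  by move=> [u v] /=; rewrite gE xpair_eqE -!val_eqE.
move=> /msetP MT ->; have -> : M = mset0.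
  by apply/msetP => v; move: (MT v); rewrite /= !msetE2 mset0E -[LHS]addn0 => /addnI.
by rewrite msetD0 /gap_mset /boundary /= eqxx; congr (gapS' _ `+` gapS' _); lia.
Qed.

Lemma gaps_msetT n : gaps_mset [set: 'I_n] = mset0.
Proof.
apply: big1 => p /gapP[Ai Aj ij E].
have -> : gap_mset n p.1 p.2 = gap_mset n p.1 p.1.+1.
  have [e|ne] := eqVneq (p.2 : nat) p.1.+1; first by rewrite e.
  have lt : p.1.+1 < p.2 by rewrite ltn_neqAle eq_sym ne.
  have xn : p.1 < n by rewrite -ltnS (leq_trans lt) ?(occ_bound _ _ _ Aj).
  have : ~~ occ [set: 'I_n] p.1.+1 by apply: E; rewrite leqnn.
  by rewrite (occ_cell _ _ (Ordinal xn)) inE.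
by rewrite /gap_mset subSnn /gapS' gapS0; case: ifP.
Qed.

Lemma G0 : G mset0 = 1.
Proof.
rewrite (@G_bound _ 0) ?big_geq //.
by apply/bigmax_leqP_seq => i; rewrite msuppE in_mset0.
Qed.

Theorem theorem5 (n : nat) (hn : 1 <= n) :
  P1 n = \sum_(1 <= i < n.+1) G (gapS' (i - 1) `+` gapS' (n - i)).
Proof.
have T0 : [set: 'I_n] != set0 by apply/set0Pn; exists (Ordinal hn).
(* The first choice is free, so the empty set gets the sum over the first payphone instead of a
   value of [G]. *)
pose C (A : {set 'I_n}) :=
  if A == set0 then \sum_(x : 'I_n) G (gaps_mset [set x]) else G (gaps_mset A).
rewrite /P1 /payphone_perm1 (card_perm_rule n (@P1_choice n) C).
(* The position [x] counted from 0 corresponds to the index i = x + 1. *)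
- rewrite /C eqxx big_add1 big_mkord; apply: eq_bigr => x _.
  by rewrite gaps_mset1 subn1.
- by move=> A x /andP[].
- by rewrite /C (negPf T0) gaps_msetT G0.
move=> A AT; have U0 x : x |: A == set0 = false.
  by apply/negbTE/set0Pn; exists x; rewrite setU11.
under eq_bigr do rewrite /C U0.
rewrite /C; case: ifPn => [/eqP ->|A0]; last exact: G_gaps_mset_step.
by apply: eq_big => x; rewrite ?setU0 // /P1_choice eqxx inE.
Qed.
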